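(* Let $r,n\ge1$ be integers, $c,d\in\mathbb{Z}$, $\mathscr{d}_1=\gcd(c-d,n)$, $\mathscr{d}_2=\gcd(c+(r-1)d,n)$, and $\rho=(r-1,\dots,2,1,0)$. Consider the map $\theta_{\boldsymbol{z}}$ from the Whittaker space $\mathfrak{W}$ (with basis indexed by cosets $\boldsymbol{\nu}+\Lambda_{fin}$ in $(\mathbb{Z}/n\mathbb{Z})^r/\Lambda_{fin}$) to $V_+(z_1)\otimes\cdots\otimes V_+(z_r)$ (with basis indexed by $(\mathbb{Z}/(n/\mathscr{d}_1)\mathbb{Z})^r$) sending the basis vector indexed by a chosen representative $\boldsymbol{\nu}\in(\mathbb{Z}/n\mathbb{Z})^r$ to the basis vector indexed by $\rho-\boldsymbol{\nu}\pmod{n/\mathscr{d}_1}$ (componentwise). Then $\theta_{\boldsymbol{z}}$ is well-defined independently of the choice of coset representatives (equivalently, $\boldsymbol{\nu}\mapsto\rho-\boldsymbol{\nu}\bmod n/\mathscr{d}_1$ is constant on cosets of $\Lambda_{fin}$) if and only if \[\gcd\left(\mathscr{d}_2,\frac{dn}{\mathscr{d}_1}\right)=\gcd(c,d,n).\]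
   Context: $B_{c,d}$ is the $r\times r$ matrix with diagonal entries $c$ and off-diagonal entries $d$, and $\Lambda_{fin}=\{\boldsymbol{x}\in(\mathbb{Z}/n\mathbb{Z})^r:B_{c,d}\boldsymbol{x}\equiv\boldsymbol{0}\pmod n\}$. $\mathfrak{W}=\mathfrak{W}^{\boldsymbol{z}}$ is the space of Whittaker functions on the principal series representation with Satake parameters $\boldsymbol{z}=(z_1,\dots,z_r)\in\mathbb{C}^r$ of the $n$-fold metaplectic cover of $GL_r(F)$ attached to $B_{c,d}$; its basis is indexed by $\widetilde{T}/H\cong(\mathbb{Z}/n\mathbb{Z})^r/\Lambda_{fin}$. $V_+(z)$ is the $n/\mathscr{d}_1$-dimensional evaluation module of the quantum affine algebra $U_q(\widehat{\mathfrak{gl}}(n/\mathscr{d}_1))$, with basis indexed by $\mathbb{Z}/(n/\mathscr{d}_1)\mathbb{Z}$. *)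

(* Defs.v *)
From HB Require Import structures.
From mathcomp Require Import all_boot all_order all_algebra all_fingroup.
From mathcomp Require Import reals complex.
Set Implicit Arguments.
Unset Strict Implicit.
Unset Printing Implicit Defensive.
Import Order.TTheory GRing.Theory Num.Theory.
Local Open Scope ring_scope.

(* Z/nZ for n >= 1. 'Z_n is unsuitable because 'Z_1 is Z/2Z. For n > 0 the
   type 'I_n.-1.+1 has exactly n elements and carries addition modulo n;
   integers act on it by x *~ k. *)
Notation Zmod n := 'I_n.-1.+1.

Definition Bmx (r : nat) (c d : int) : 'M[int]_r :=
  \matrix_(i, j) (if i == j then c else d).

(* Reduction Z/nZ -> Z/mZ; it is meaningful only when m divides n. *)
Definition redZ (n m : nat) (x : Zmod n) : Zmod m := inZp x.

Definition rho (r n : nat) : 'cV[Zmod n]_r := \col_i inZp (r.-1 - i).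

Definition rho_minus (r n m : nat) (nu : 'cV[Zmod n]_r) : 'cV[Zmod m]_r :=
  map_mx (@redZ n m) (rho r n - nu).

Section LambdaFin.
Variables (r n : nat) (c d : int).

(* B x = 0 in (Z/nZ)^r, with the integer entries of B acting on Z/nZ. *)
Definition Lambda_fin : {set 'cV[Zmod n]_r} :=
  [set x : 'cV[Zmod n]_r | [forall i, \sum_j x j 0 *~ Bmx r c d i j == 0]].

Lemma Lambda_fin_group_set : group_set Lambda_fin.
Proof.
apply/group_setP; split=> [|x y].
  rewrite inE; apply/forallP=> i; rewrite big1 // => j _.
  by rewrite mxE mul0rz.
rewrite !inE => /forallP hx /forallP hy; apply/forallP=> i.
rewrite (eq_bigr (fun j => x j 0 *~ Bmx r c d i j + y j 0 *~ Bmx r c d i j)).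
  by rewrite big_split /= (eqP (hx i)) (eqP (hy i)) addr0.
by move=> j _; rewrite mxE mulrzDl.
Qed.

Canonical Lambda_fin_group := Group Lambda_fin_group_set.

End LambdaFin.

(* (Z/nZ)^r / Lambda_fin: the group law on 'cV is addition, so every subgroup
   is normal and coset_of is the full quotient. *)
Definition Tmod (r n : nat) (c d : int) := coset_of (Lambda_fin r n c d).

Lemma coset_Lambda_finE (r n : nat) (c d : int) (nu nu' : 'cV[Zmod n]_r) :
  (coset (Lambda_fin r n c d) nu = coset (Lambda_fin r n c d) nu') <->
  (nu - nu' \in Lambda_fin r n c d).
Proof.
have nrm x : x \in ('N(Lambda_fin r n c d))%g.
  rewrite inE; apply/subsetP=> _ /imsetP[y yL ->].
  by rewrite conjgE (_ : (x^-1 * (y * x))%g = y) // [LHS]addrC addrK.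
rewrite -[nu - nu']/((nu * nu'^-1)%g) -mem_rcoset.
by split=> /(rcoset_kercosetP (nrm nu) (nrm nu')).
Qed.

Section LinearAlgebra.
Variable K : fieldType.

Definition is_basis (I : finType) (V : vectType K) (b : I -> V) : bool :=
  basis_of fullv (codom b).

Definition lin_ext (I : finType) (V U : vectType K) (b : I -> V) (e : I -> U) :
    'Hom(V, U) :=
  linfun (fun v => \sum_(x : I) coord (codom_tuple b) (enum_rank x) v *: e x).

Lemma lin_extE (I : finType) (V U : vectType K) (b : I -> V) (e : I -> U) :
  is_basis b -> forall x, lin_ext b e (b x) = e x.
Proof.
move=> hb x; have hf : free (codom_tuple b) by apply: basis_free hb.
pose g v := \sum_(y : I) coord (codom_tuple b) (enum_rank y) v *: e y.
have g_lin : linear g.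
  move=> a u v; rewrite /g scaler_sumr -big_split /=; apply: eq_bigr => y _.
  by rewrite linearP scalerDl scalerA.
pose gL := GRing.isLinear.Build K V U *:%R g g_lin.
pose G : {linear V -> U} := HB.pack g gL.
rewrite (_ : lin_ext b e = linfun G) // lfunE /= /g.
have bx : b x = (codom_tuple b)`_(enum_rank x).
  by rewrite /= (nth_codom _ _ (enum_rank x)) enum_rankK.
rewrite (bigD1 x) //= {1}bx coord_free // eqxx scale1r big1 ?addr0 // => y yx.
by rewrite {1}bx coord_free // (inj_eq enum_rank_inj) eq_sym (negPf yx) scale0r.
Qed.

Section Tensor.
Variables (r : nat) (V : 'I_r -> vectType K).

Definition multilinear (U : vectType K) (f : (forall i, V i) -> U) : Prop :=
  forall (x : forall i, V i) (i : 'I_r) (a : K) (u v : V i),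
    f (dfwith x (a *: u + v)) = a *: f (dfwith x u) + f (dfwith x v).

(* (T, t) is a tensor product of the V i, by the universal property among
   finite-dimensional spaces. *)
Definition is_tensor_product (T : vectType K) (t : (forall i, V i) -> T) : Prop :=
  multilinear t /\
  forall (U : vectType K) (f : (forall i, V i) -> U), multilinear f ->
    exists! g : 'Hom(T, U), forall x, g (t x) = f x.

End Tensor.
End LinearAlgebra.

Definition d1 (n : nat) (c d : int) : nat := gcdn `|c - d| n.
Definition d2 (r n : nat) (c d : int) : nat := gcdn `|c + (r%:Z - 1) * d| n.

Definition is_section (r n : nat) (c d : int)
    (s : Tmod r n c d -> 'cV[Zmod n]_r) : Prop :=
  forall x, coset (Lambda_fin r n c d) (s x) = x.

(* W stands for the Whittaker space and Vp a for the evaluation module V_+(a).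
   theta_z is a map of vector spaces, so only these spaces and their indexed
   bases w and v a are used, not the group or quantum group actions. *)
Section Theta.
Variables (K : fieldType) (r n : nat) (c d : int).
Let N := (n %/ d1 n c d)%N.
Variables (W : vectType K) (w : Tmod r n c d -> W).
Variables (Vp : K -> vectType K) (v : forall a : K, Zmod N -> Vp a).
Variable z : 'I_r -> K.
Variables (T : vectType K) (t : (forall i, Vp (z i)) -> T).

Definition tensor_basis (k : 'cV[Zmod N]_r) : T := t (fun i => v (z i) (k i 0)).

(* theta_z, computed from the choice s of coset representatives. *)
Definition theta (s : Tmod r n c d -> 'cV[Zmod n]_r) : 'Hom(W, T) :=
  lin_ext w (fun x => tensor_basis (rho_minus N (s x))).

Definition theta_well_defined : Prop :=
  forall s s', is_section s -> is_section s' -> theta s = theta s'.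

End Theta.

Definition constant_on_cosets (r n : nat) (c d : int) : Prop :=
  forall nu nu' : 'cV[Zmod n]_r,
    coset (Lambda_fin r n c d) nu = coset (Lambda_fin r n c d) nu' ->
    rho_minus (n %/ d1 n c d) nu = rho_minus (n %/ d1 n c d) nu'.

(* Main.v *)
(** A vector x is in Lambda_fin iff (c - d) x_i + d S = 0 mod n for all i, where
    S is the sum of the coordinates, and n / d1 divides x_i iff n divides
    (c - d) x_i. So theta is well defined iff n | d S for every x in Lambda_fin.
    With G = gcd(d2, d n / d1), the sums S that occur are exactly those with
    n | G S: n | d2 S comes from adding up all the congruences, and
    n | (d n / d1) S from d1 | d S. Hence the condition is G | d, which is
    equivalent to G = gcd(c, d, n). That distinct representatives modulo n / d1
    give distinct vectors in the tensor product is seen by evaluating, through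
    the universal property, products of coordinate functions. *)

Require Import Defs.
From HB Require Import structures.
From mathcomp Require Import all_boot all_order all_algebra all_fingroup.
From mathcomp Require Import reals complex.
From mathcomp Require Import ring.
Import Order.TTheory GRing.Theory Num.Theory.
Local Open Scope ring_scope.

Set Implicit Arguments.
Unset Strict Implicit.

(** * Residues modulo n through integer representatives *)

Definition zmodz (n : nat) (k : int) : Zmod n := inZp 1 *~ k.

Lemma zmodz_nat (n k : nat) : zmodz n k%:Z = inZp k.
Proof.
rewrite /zmodz -pmulrn Zp_mulrn; apply/val_inj => /=.
by rewrite modnMml mul1n.
Qed.

Lemma zmodz_ord (n : nat) (x : Zmod n) : zmodz n (x : nat)%:Z = x.
Proof. by rewrite zmodz_nat valZpK. Qed.

Lemma zmodzB (n : nat) (j k : int) : zmodz n (j - k) = zmodz n j - zmodz n k.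
Proof. exact: mulrzBr. Qed.

Lemma zmodz_eq0 (n : nat) (k : int) :
  (0 < n)%N -> (zmodz n k == 0) = (n%:Z %| k)%Z.
Proof.
move=> n_gt0.
have nat_eq0 j : (zmodz n j%:Z == 0) = (n %| j)%N.
  by rewrite zmodz_nat -val_eqE /= prednK.
rewrite dvdzE -[`|n%:Z|%N]/n; case: (intP k) => [|j|j]; rewrite ?nat_eq0 //.
by rewrite abszN -[in RHS]nat_eq0 -oppr_eq0 /zmodz mulrNz opprK.
Qed.

(** [Bmx] is (c - d) times the identity plus d times the all-ones matrix. *)
Lemma mem_Lambda_fin (r n : nat) (c d : int) (y : 'I_r -> int) :
  (0 < n)%N ->
  (\col_i zmodz n (y i) \in Lambda_fin r n c d) =
  [forall i, (n%:Z %| (c - d) * y i + d * \sum_j y j)%Z].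
Proof.
move=> n_gt0; rewrite inE; apply: eq_forallb => i; rewrite -zmodz_eq0 //.
congr (_ == _); rewrite (eq_bigr (fun j => zmodz n (y j * Bmx r c d i j))).
  rewrite -mulrz_sumr /zmodz; congr (_ *~ _).
  rewrite mulr_sumr (bigD1 i) //= [in RHS](bigD1 i) //= mxE eqxx.
  rewrite (eq_bigr (fun j => d * y j)) => [|j /negPf ji]; first by ring.
  by rewrite mxE eq_sym ji mulrC.
by move=> j _; rewrite mxE -mulrzA.
Qed.

(** The representative of [x - y] in Z/nZ and the integer difference of the representatives agree
    modulo n, hence modulo m. *)
Lemma eq_redZ (n m : nat) (x y : Zmod n) :
  (0 < n)%N -> (0 < m)%N -> (m %| n)%N ->
  (redZ m x == redZ m y) = (m %| (x - y : Zmod n)%R)%N.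
Proof.
move=> n_gt0 m_gt0 mn; rewrite /redZ -!zmodz_nat -subr_eq0 -zmodzB zmodz_eq0 //.
have : (n%:Z %| (x : nat)%:Z - (y : nat)%:Z - ((x - y : Zmod n)%R : nat)%:Z)%Z.
  by rewrite -zmodz_eq0 // !zmodzB !zmodz_ord subrr.
move/(dvdz_trans (mn : (m%:Z %| n%:Z)%Z)) => h.
by rewrite -[in LHS](subrK ((x - y : Zmod n)%R : nat)%:Z (_ - _)) (rpredDl _ h).
Qed.

(** Multiplying by gcd(a, n) turns the left side into n | gcd(a k, n k), where n | n k is
    automatic. *)
Lemma dvdn_div_gcd (n a k : nat) :
  (0 < n)%N -> (n %/ gcdn a n %| k)%N = (n %| a * k)%N.
Proof.
move=> n_gt0; have g_gt0 : (0 < gcdn a n)%N by rewrite gcdn_gt0 n_gt0 orbT.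
rewrite -(dvdn_pmul2r g_gt0) divnK ?dvdn_gcdr // mulnC muln_gcdl dvdn_gcd.
by rewrite (dvdn_mulr k (dvdnn n)) andbT mulnC.
Qed.

(** * Constancy on cosets as a condition on integer vectors *)

Lemma dvdn_div_d1 (n : nat) (c d : int) (x : Zmod n) :
  (0 < n)%N -> (n %/ d1 n c d %| x)%N = (x *~ (c - d) == 0).
Proof.
move=> n_gt0; rewrite /d1 dvdn_div_gcd // -[X in X *~ _]zmodz_ord /zmodz -mulrzA.
by rewrite zmodz_eq0 // dvdzE abszM mulnC.
Qed.

Lemma d1_gt0 (n : nat) (c d : int) : (0 < n)%N -> (0 < d1 n c d)%N.
Proof. by move=> n_gt0; rewrite gcdn_gt0 n_gt0 orbT. Qed.

Lemma d1_dvdn (n : nat) (c d : int) : (d1 n c d %| n)%N.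
Proof. exact: dvdn_gcdr. Qed.

Lemma subrBB_l (V : zmodType) (a x y : V) : a - x - (a - y) = y - x.
Proof. by rewrite opprB addrC addrA subrK. Qed.

(** The vector [rho] cancels in a difference of two images, so only the reduction modulo n / d1 of
    elements of [Lambda_fin] matters. *)
Lemma constant_on_cosetsP (r n : nat) (c d : int) : (0 < n)%N ->
  constant_on_cosets r n c d <->
  forall x, x \in Lambda_fin r n c d -> forall i, x i 0 *~ (c - d) == 0.
Proof.
move=> n_gt0; set N := (n %/ d1 n c d)%N.
have Nn : (N %| n)%N by rewrite dvdn_div // d1_dvdn.
have N_gt0 : (0 < N)%N by rewrite (dvdn_gt0 n_gt0).
split=> [const x xL i | killed nu nu' /coset_Lambda_finE nuL].
  have : rho_minus N (0 : 'cV[Zmod n]_r) = rho_minus N x.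
    by apply: esym; apply: const; apply/coset_Lambda_finE; rewrite subr0.
  move/matrixP/(_ i 0)/eqP; rewrite !mxE eq_redZ //.
  by rewrite subrBB_l subr0 dvdn_div_d1.
apply/matrixP => i j; rewrite ord1; apply/esym/eqP; rewrite !mxE eq_redZ //.
have := killed _ nuL i; rewrite !mxE -dvdn_div_d1 //.
by rewrite subrBB_l.
Qed.

Lemma constant_on_cosets_int (r n : nat) (c d : int) : (0 < n)%N ->
  constant_on_cosets r n c d <->
  forall y : 'I_r -> int,
    (forall i, n%:Z %| (c - d) * y i + d * \sum_j y j)%Z ->
    forall i, (n%:Z %| (c - d) * y i)%Z.
Proof.
move=> n_gt0; rewrite constant_on_cosetsP //; split=> [killed y yL i | killed x].
  have /killed/(_ i) : \col_i zmodz n (y i) \in Lambda_fin r n c d.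
    by rewrite mem_Lambda_fin //; apply/forallP.
  by rewrite mxE /zmodz -mulrzA mulrC zmodz_eq0.
have -> : x = \col_i zmodz n (x i 0 : nat)%:Z.
  by apply/matrixP => i j; rewrite ord1 !mxE zmodz_ord.
rewrite mem_Lambda_fin // => /forallP /killed xL i.
by rewrite mxE /zmodz -mulrzA mulrC zmodz_eq0.
Qed.

(** * The gcd criterion for integer vectors *)

Lemma constant_iff_gcd_dvd (r n : nat) (c d : int) :
  (0 < r)%N -> (0 < n)%N ->
  (forall y : 'I_r -> int,
    (forall i, n%:Z %| (c - d) * y i + d * \sum_j y j)%Z ->
    forall i, (n%:Z %| (c - d) * y i)%Z) <->
  (gcdz (d2 r n c d)%:Z ((d * n%:Z) %/ (d1 n c d)%:Z)%Z %| d)%Z.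
Proof.
move=> r_gt0 n_gt0; set e1 := (d1 n c d)%:Z; set e2 := (d2 r n c d)%:Z.
have e1E : e1 = gcdz (c - d) n%:Z by [].
have e2E : e2 = gcdz (c + (r%:Z - 1) * d) n%:Z by [].
have e1_neq0 : e1 != 0 by rewrite -lt0n d1_gt0.
have [q nE] : exists q, n%:Z = q * e1 by apply/dvdzP; exact: d1_dvdn.
have dnE : ((d * n%:Z) %/ e1)%Z = d * q by rewrite nE mulrA mulzK.
rewrite dnE; set G := gcdz e2 (d * q).
have Ge2 : (G %| e2)%Z := dvdz_gcdl _ _.
have Gdq : (G %| d * q)%Z := dvdz_gcdr _ _.
have e2C : (e2 %| c + (r%:Z - 1) * d)%Z by rewrite e2E dvdz_gcdl.
have e2n : (e2 %| n%:Z)%Z by rewrite e2E dvdz_gcdr.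
split=> [killed | Gd y yL i].
  (* The test vector will have coordinate sum S = n / G: once n | d S is known, cancelling S gives G
     | d. *)
  have [S nS] : exists S, n%:Z = S * G by apply/dvdzP/(dvdz_trans Ge2).
  have [k dqE] : exists k, d * q = k * G by apply/dvdzP.
  have [C CE] : exists C, c + (r%:Z - 1) * d = C * G by apply/dvdzP/(dvdz_trans Ge2).
  have G_neq0 : G != 0.
    by apply/eqP => G0; move: nS n_gt0; rewrite G0 mulr0 => -[->].
  have dS : d * S = k * e1.
    by apply: (mulIf G_neq0); rewrite -mulrA -nS nE mulrA dqE; ring.
  have [u [v uv]] := Bezoutz (c - d) n%:Z.
  (* S is a multiple of n / d2 with d1 | d S, so (c - d) x0 = - d S is solvable
     modulo n; every coordinate but one is x0, and that one makes the sum S. *)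
  pose x0 := - (u * k).
  pose i0 := Ordinal r_gt0.
  pose y i := if i == i0 then S - (r%:Z - 1) * x0 else x0.
  have sum_y : \sum_j y j = S.
    rewrite (bigD1 i0) //= {1}/y eqxx (eq_bigr (fun=> x0)) => [|j /negPf]; last first.
      by rewrite /y => ->.
    rewrite sumr_const cardC1 card_ord -mulr_natl.
    by rewrite -subn1 natrB // natz subrK.
  (* This is Bezout's identity u (c - d) + v n = d1, scaled by k. *)
  have x0L : (c - d) * x0 + d * S = k * v * n%:Z.
    by rewrite dS e1E -uv /x0; ring.
  have yL i : (n%:Z %| (c - d) * y i + d * \sum_j y j)%Z.
    rewrite sum_y /y; case: eqP => _; last by rewrite x0L dvdz_mull.
    (* All r rows add up to (c + (r - 1) d) S; removing the r - 1 rows with coordinate x0 leaves row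
       [i0]. The total is C G S = C n. *)
    rewrite (_ : _ + _ = (c + (r%:Z - 1) * d) * S
      - (r%:Z - 1) * ((c - d) * x0 + d * S)); last by ring.
    rewrite x0L CE -mulrA [G * S]mulrC -nS.
    by apply: rpredB; rewrite !dvdz_mull.
  have := yL i0; rewrite (rpredDl _ (killed y yL i0)) sum_y nS mulrC.
  rewrite dvdz_mul2l //; apply/eqP => S0.
  by move: nS n_gt0; rewrite S0 mul0r => -[->].
set S := \sum_j y j in yL.
have nCS : (n%:Z %| (c + (r%:Z - 1) * d) * S)%Z.
  have : (n%:Z %| \sum_(j < r) ((c - d) * y j + d * S))%Z.
    exact: rpred_sum.
  rewrite big_split /= -mulr_sumr -/S sumr_const card_ord -mulr_natl.
  by congr (_ %| _)%Z; ring.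
have ne2S : (n%:Z %| e2 * S)%Z.
  have [u [v uv]] := Bezoutz (c + (r%:Z - 1) * d) n%:Z; rewrite e2E -uv.
  by rewrite mulrDl; apply: rpredD; rewrite -mulrA dvdz_mull // dvdz_mulr.
(* Row i is read modulo d1, which divides both n and (c - d) y_i. *)
have [k dSE] : exists k, d * S = k * e1.
  have e1cd : (e1 %| (c - d) * y i)%Z by rewrite dvdz_mulr // e1E dvdz_gcdl.
  apply/dvdzP; rewrite -(rpredDl _ e1cd); apply: dvdz_trans (yL i).
  by rewrite e1E dvdz_gcdr.
have ndqS : (n%:Z %| d * q * S)%Z.
  by rewrite mulrAC dSE -mulrA [e1 * q]mulrC -nE dvdz_mull.
have nGS : (n%:Z %| G * S)%Z.
  rewrite /G; have [u [v <-]] := Bezoutz e2 (d * q).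
  by rewrite mulrDl; apply: rpredD; rewrite -mulrA dvdz_mull.
rewrite -(rpredDr _ (_ : n%:Z %| d * S)%Z) //.
by move/dvdzP: Gd => [f ->]; rewrite -mulrA dvdz_mull.
Qed.

(** gcd(c, d, n) always divides G. Conversely G divides d2, hence n and c + (r - 1) d, so G | d
    forces G | c as well. *)
Lemma gcdz_eq_gcd_cdn (r n : nat) (c d : int) : (0 < n)%N ->
  let G := gcdz (d2 r n c d)%:Z ((d * n%:Z) %/ (d1 n c d)%:Z)%Z in
  G = gcdz (gcdz c d) n%:Z <-> (G %| d)%Z.
Proof.
move=> n_gt0 G; split=> [-> | Gd].
  by apply: dvdz_trans (dvdz_gcdl _ _) (dvdz_gcdr _ _).
have Ge2 : (G %| (d2 r n c d)%:Z)%Z := dvdz_gcdl _ _.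
have e2n : ((d2 r n c d)%:Z %| n%:Z)%Z := dvdn_gcdr _ _.
have Gn := dvdz_trans Ge2 e2n.
have e2C : ((d2 r n c d)%:Z %| c + (r%:Z - 1) * d)%Z := dvdn_gcdl _ _.
have GC := dvdz_trans Ge2 e2C.
have Gc : (G %| c)%Z by rewrite -(rpredDr _ (_ : G %| (r%:Z - 1) * d)%Z) ?dvdz_mull.
have Gg : (G %| gcdz (gcdz c d) n%:Z)%Z by rewrite !dvdz_gcd Gc Gd Gn.
have gG : (gcdz (gcdz c d) n%:Z %| G)%Z.
  set g := gcdz (gcdz c d) n%:Z.
  have gn : (g %| n%:Z)%Z := dvdz_gcdr _ _.
  have gcd' : (g %| gcdz c d)%Z := dvdz_gcdl _ _.
  have gc := dvdz_trans gcd' (dvdz_gcdl _ _).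
  have gd := dvdz_trans gcd' (dvdz_gcdr _ _).
  rewrite dvdz_gcd; apply/andP; split.
    rewrite -[(d2 r n c d)%:Z]/(gcdz (c + (r%:Z - 1) * d) n%:Z).
    by rewrite dvdz_gcd gn rpredD ?dvdz_mull.
  have [q ->] : exists q, n%:Z = q * (d1 n c d)%:Z by apply/dvdzP; exact: d1_dvdn.
  by rewrite mulrA mulzK ?dvdz_mulr // -lt0n d1_gt0.
(* Both gcds are nonnegative, so mutual divisibility is equality. *)
by move: Gg gG; rewrite !dvdzE => Gg gG; congr Posz; apply/eqP; rewrite eqn_dvd Gg.
Qed.

(** * Separating basis tensors, and independence of the section *)

Section TensorBasis.
Variable K : fieldType.

(** The codomain is [K^o] because the universal property asks for a vector space as target. *)
Definition coord_prod r (I : 'I_r -> finType) (V : 'I_r -> vectType K)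
   (b : forall i, I i -> V i) (k : forall i, I i) (x : forall i, V i) : K^o :=
  \prod_i coord (codom_tuple (b i)) (enum_rank (k i)) (x i).

Lemma coord_basis (I : finType) (V : vectType K) (b : I -> V) (k j : I) :
  is_basis b -> coord (codom_tuple b) (enum_rank k) (b j) = (j == k)%:R.
Proof.
move=> b_basis; have b_free : free (codom_tuple b) by apply: basis_free b_basis.
have -> : b j = (codom_tuple b)`_(enum_rank j).
  by rewrite /= (nth_codom _ _ (enum_rank j)) enum_rankK.
by rewrite coord_free // (inj_eq enum_rank_inj).
Qed.

Lemma coord_prod_multilinear r (I : 'I_r -> finType) (V : 'I_r -> vectType K)
   (b : forall i, I i -> V i) (k : forall i, I i) :
  multilinear (coord_prod b k).
Proof.
move=> x i a u v; rewrite /coord_prod 3!(bigD1 i isT) /= !dfwith_in linearP mulrDl.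
have eq_out (w : V i) : \prod_(j < r | j != i)
    coord (codom_tuple (b j)) (enum_rank (k j)) (dfwith x w j) =
  \prod_(j < r | j != i) coord (codom_tuple (b j)) (enum_rank (k j)) (x j).
  by apply: eq_bigr => j ji; rewrite dfwith_out // eq_sym.
by rewrite !eq_out /= -mulrA.
Qed.

(** The linear form induced by [coord_prod b k] takes the value 1 on the tensor indexed by k, and on
    the one indexed by l a product of Kronecker deltas, which vanishes if k and l differ
    anywhere. *)
Lemma tensor_basis_inj r (I : 'I_r -> finType) (V : 'I_r -> vectType K)
    (b : forall i, I i -> V i) (T : vectType K) (t : (forall i, V i) -> T)
    (k l : forall i, I i) :
  (forall i, is_basis (b i)) -> is_tensor_product t ->
  t (fun i => b i (k i)) = t (fun i => b i (l i)) -> forall i, k i = l i.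
Proof.
move=> b_basis [_ univ] tkl i.
have [g [gE _]] := univ _ _ (coord_prod_multilinear b k).
have : coord_prod b k (fun i => b i (l i)) = 1.
  rewrite -gE -tkl gE /coord_prod big1 // => j _.
  by rewrite coord_basis // eqxx.
rewrite /coord_prod (bigD1 i) //= coord_basis //.
by case: eqP => // _ /eqP; rewrite mul0r eq_sym oner_eq0.
Qed.

Lemma theta_well_definedP (r n : nat) (c d : int) (z : 'I_r -> K)
  (W : vectType K) (w : Tmod r n c d -> W) (Vp : K -> vectType K)
  (v : forall a : K, Zmod (n %/ d1 n c d)%N -> Vp a)
  (T : vectType K) (t : (forall i : 'I_r, Vp (z i)) -> T) :
  is_basis w -> (forall a, is_basis (v a)) -> is_tensor_product t ->
  theta_well_defined w v t <-> constant_on_cosets r n c d.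
Proof.
move=> w_basis v_basis t_tensor; split=> [wd nu nu' nunu' | const s s' sP s'P].
  (* The section [repr] is altered at one coset to take the value [mu] there, so [nu] and [nu'] both
     occur as chosen representatives of their common coset. *)
  pose s mu (x : Tmod r n c d) :=
    if x == coset (Lambda_fin r n c d) mu then mu else repr x.
  have sP mu : is_section (s mu).
    by move=> x; rewrite /s; case: eqP => // _; exact: coset_reprK.
  have sE mu x : x = coset (Lambda_fin r n c d) mu -> s mu x = mu.
    by rewrite /s => ->; rewrite eqxx.
  have := congr1 (fun f : 'Hom(W, T) => f (w (coset (Lambda_fin r n c d) nu)))
    (wd _ _ (sP nu) (sP nu')).
  rewrite /theta !lin_extE // !sE // => tnu.
  apply/matrixP => i j; rewrite ord1.
  exact: (tensor_basis_inj (fun i => v_basis (z i)) t_tensor tnu).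
congr lin_ext; apply: boolp.funext => x; congr (tensor_basis _ _ _).
by apply: const; rewrite sP s'P.
Qed.

End TensorBasis.

Unset Implicit Arguments.
Set Strict Implicit.

Theorem theorem8p3 (R : realType) (r n : nat) (c d : int)
  (hr : (0 < r)%N) (hn : (0 < n)%N)
  (z : 'I_r -> R[i])
  (W : vectType R[i]) (w : Tmod r n c d -> W) (hw : is_basis w)
  (Vp : R[i] -> vectType R[i])
  (v : forall a : R[i], Zmod (n %/ d1 n c d)%N -> Vp a)
  (hv : forall a : R[i], is_basis (v a))
  (T : vectType R[i]) (t : (forall i : 'I_r, Vp (z i)) -> T)
  (ht : is_tensor_product t) :
  (theta_well_defined w v t <-> constant_on_cosets r n c d) /\
  (theta_well_defined w v t <->
     gcdz (d2 r n c d)%:Z ((d * n%:Z) %/ (d1 n c d)%:Z)%Z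
       = gcdz (gcdz c d) n%:Z).
Proof.
have wdP := theta_well_definedP hw hv ht; split=> //.
by rewrite wdP constant_on_cosets_int // constant_iff_gcd_dvd // gcdz_eq_gcd_cdn.
Qed.
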